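(* Let $a,b\in\mathbb{C}$ with $b\neq0$, and let $\alpha,\bar\alpha,\beta\in\mathbb{C}$ with $\alpha,\bar\alpha\neq0$. Consider extensions $0\to M_{\bar\alpha,\beta}\to E\to M_{\alpha,\beta}\to0$ of $\mathcal{W}(a,b)$-modules (so $\bar\beta=\beta$), written as $E=\mathbb{C}[\partial]v_{\bar\alpha}\oplus\mathbb{C}[\partial]v_\alpha$ with $L_\lambda v_\alpha=(\partial+\alpha\lambda+\beta)v_\alpha+f(\partial,\lambda)v_{\bar\alpha}$, $W_\lambda v_\alpha=g(\partial,\lambda)v_{\bar\alpha}$. Then in every such extension $g=0$. A nontrivial such extension exists if and only if one of the following holds, and then every nontrivial extension is equivalent to one with $g=0$ and $f(\partial,\lambda)=F(\partial+\beta,\lambda)$ with $F$ as indicated: (i) $\alpha=\bar\alpha$ and $F(\partial,\lambda)=a_0+a_1\lambda$ with $(a_0,a_1)\neq(0,0)$; (ii) $\alpha-\bar\alpha=2$ and $F=c\,\lambda^2(2\partial+\lambda)$, $c\neq0$; (iii) $\alpha-\bar\alpha=3$ and $F=c\,\partial\lambda^2(\partial+\lambda)$, $c\neq0$; (iv) $\alpha-\bar\alpha=4$ and $F=c\,\lambda^2(4\partial^3+6\partial^2\lambda-\partial\lambda^2+\bar\alpha\lambda^3)$, $c\neq0$; (v) $\alpha=1$, $\bar\alpha=-4$ and $F=c(\partial^4\lambda^2-10\partial^2\lambda^4-17\partial\lambda^5-8\lambda^6)$, $c\neq0$; (vi) $\alpha=\frac72\pm\frac{\sqrt{19}}2$,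 $\bar\alpha=-\frac52\pm\frac{\sqrt{19}}2$ (same sign) and $F=c\big(\partial^4\lambda^3-(2\bar\alpha+3)\partial^3\lambda^4-3\bar\alpha\partial^2\lambda^5-(3\bar\alpha+1)\partial\lambda^6-(\bar\alpha+\frac{9}{28})\lambda^7\big)$, $c\neq0$.
   Context: A conformal module over a Lie conformal algebra $\mathcal{R}$ is a $\mathbb{C}[\partial]$-module $V$ with $\mathbb{C}$-linear maps $\mathcal{R}\otimes V\to V[\lambda]$, $a\otimes v\mapsto a_\lambda v$, such that $(\partial a)_\lambda v=-\lambda a_\lambda v$, $a_\lambda(\partial v)=(\partial+\lambda)a_\lambda v$, and $a_\lambda(b_\mu v)-b_\mu(a_\lambda v)=[a_\lambda b]_{\lambda+\mu}v$. The Lie conformal algebra $\mathcal{W}(a,b)$ is the free $\mathbb{C}[\partial]$-module on $L,W$ with $[L_\lambda L]=(\partial+2\lambda)L$, $[L_\lambda W]=(\partial+a\lambda+b)W$, $[W_\lambda W]=0$. For $(a,b)\neq(1,0)$ and $\alpha\neq0$, $M_{\alpha,\beta}=\mathbb{C}[\partial]v$ with $L_\lambda v=(\partial+\alpha\lambda+\beta)v$, $W_\lambda v=0$. Every extension of $M_{\alpha,\beta}$ by $M_{\bar\alpha,\bar\beta}$ can be written in the displayed form with $f,g\in\mathbb{C}[\partial,\lambda]$, where $\mathbb{C}[\partial]v_{\bar\alpha}\cong M_{\bar\alpha,\bar\beta}$ is a submodule. Equivalence of extensions means a module homomorphism between middle terms compatible with the identities on the end terms; trivial means equivalent to the direct sum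 extension. *)

(* Defs.v *)
From HB Require Import structures.
From mathcomp Require Import all_boot all_order all_algebra.
Set Implicit Arguments. Unset Strict Implicit. Unset Printing Implicit Defensive.
Import Order.TTheory GRing.Theory Num.Theory.
Local Open Scope ring_scope.

(* Elements of E = C[d] v_abar (+) C[d] v_al are pairs (p, q) standing for
   p(d) v_abar + q(d) v_al.  Bivariate polynomials f(d, lam) are elements of
   {poly {poly R}}: the OUTER variable is lam, the inner variable is d. *)

Inductive gen := GL | GW.

Definition shiftp (R : fieldType) (l : R) (h : {poly R}) : {poly R} :=
  h \Po ('X + l%:P).
Definition evl (R : fieldType) (l : R) (f : {poly {poly R}}) : {poly R} :=
  f.[l%:P].

Definition eadd (R : fieldType) (v w : {poly R} * {poly R}) :=
  (v.1 + w.1, v.2 + w.2).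
Definition esub (R : fieldType) (v w : {poly R} * {poly R}) :=
  (v.1 - w.1, v.2 - w.2).
Definition escal (R : fieldType) (c : R) (v : {poly R} * {poly R}) :=
  (c *: v.1, c *: v.2).
Definition epmul (R : fieldType) (r : {poly R}) (v : {poly R} * {poly R}) :=
  (r * v.1, r * v.2).
Definition ezero (R : fieldType) : {poly R} * {poly R} := (0, 0).

(* The lambda-action X_lam v (lam specialised to a scalar l) on the extension
   with data f, g:  L_lam v_abar = (d + abar lam + be) v_abar, W_lam v_abar = 0,
   L_lam v_al = (d + al lam + be) v_al + f(d,lam) v_abar,
   W_lam v_al = g(d,lam) v_abar, extended by X_lam (h(d) v) = h(d+lam) X_lam v. *)
Definition act (R : fieldType) (al alb be : R) (f g : {poly {poly R}})
  (X : gen) (l : R) (v : {poly R} * {poly R}) : {poly R} * {poly R} :=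
  match X with
  | GL => (shiftp l v.1 * ('X + (alb * l + be)%:P) + shiftp l v.2 * evl l f,
           shiftp l v.2 * ('X + (al * l + be)%:P))
  | GW => (shiftp l v.2 * evl l g, 0)
  end.

(* Conformal module axiom  X_lam (Y_mu v) - Y_mu (X_lam v) = [X_lam Y]_{lam+mu} v
   for the generators X, Y of W(a,b), with
   [L_lam L]_{lam+mu} = (lam - mu) L_{lam+mu},
   [L_lam W]_{lam+mu} = ((a-1) lam - mu + b) W_{lam+mu},
   [W_lam L]_{lam+mu} = (lam + (1-a) mu - b) W_{lam+mu},
   [W_lam W] = 0. *)
Definition is_ext (R : fieldType) (a b al alb be : R) (f g : {poly {poly R}}) : Prop :=
  forall (l m : R) (v : {poly R} * {poly R}),
  [/\ esub (act al alb be f g GL l (act al alb be f g GL m v))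
           (act al alb be f g GL m (act al alb be f g GL l v))
      = escal (l - m) (act al alb be f g GL (l + m) v),
      esub (act al alb be f g GL l (act al alb be f g GW m v))
           (act al alb be f g GW m (act al alb be f g GL l v))
      = escal ((a - 1) * l - m + b) (act al alb be f g GW (l + m) v),
      esub (act al alb be f g GW l (act al alb be f g GL m v))
           (act al alb be f g GL m (act al alb be f g GW l v))
      = escal (l + (1 - a) * m - b) (act al alb be f g GW (l + m) v)
    & esub (act al alb be f g GW l (act al alb be f g GW m v))
           (act al alb be f g GW m (act al alb be f g GW l v))
      = ezero R].

Definition ext_equiv (R : fieldType) (al alb be : R) (f g f' g' : {poly {poly R}}) : Prop :=
  exists phi : {poly R} * {poly R} -> {poly R} * {poly R},
  [/\ forall v w, phi (eadd v w) = eadd (phi v) (phi w),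
      forall r v, phi (epmul r v) = epmul r (phi v),
      forall p, phi (p, 0) = (p, 0),
      forall v, (phi v).2 = v.2
    & forall X l v, phi (act al alb be f g X l v) = act al alb be f' g' X l (phi v)].

Definition ext_trivial (R : fieldType) (al alb be : R) (f g : {poly {poly R}}) : Prop :=
  ext_equiv al alb be f g 0 0.

Definition subbeta (R : fieldType) (be : R) (F : {poly {poly R}}) : {poly {poly R}} :=
  map_poly (fun p : {poly R} => p \Po ('X + be%:P)) F.

Definition Pd (R : fieldType) : {poly {poly R}} := ('X : {poly R})%:P.
Definition Pl (R : fieldType) : {poly {poly R}} := 'X.
Definition cc (R : fieldType) (c : R) : {poly {poly R}} := c%:P%:P.

Definition cond1 (R : fieldType) (al alb : R) := al = alb.
Definition cond2 (R : fieldType) (al alb : R) := al - alb = 2.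
Definition cond3 (R : fieldType) (al alb : R) := al - alb = 3.
Definition cond4 (R : fieldType) (al alb : R) := al - alb = 4.
Definition cond5 (R : fieldType) (al alb : R) := al = 1 /\ alb = -4.
Definition cond6 (R : fieldType) (al alb : R) :=
  exists s : R, s ^+ 2 = 19 /\ al = 7 / 2 + s / 2 /\ alb = - (5 / 2) + s / 2.

Definition good_pair (R : fieldType) (al alb : R) : Prop :=
  cond1 al alb \/ cond2 al alb \/ cond3 al alb \/ cond4 al alb \/
  cond5 al alb \/ cond6 al alb.

Definition good_F (R : fieldType) (al alb : R) (F : {poly {poly R}}) : Prop :=
  (cond1 al alb /\ exists a0 a1 : R, (a0, a1) != (0, 0) /\
      F = cc a0 + cc a1 * Pl R)
  \/ (cond2 al alb /\ exists c : R, c != 0 /\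
      F = cc c * (Pl R) ^+ 2 * (2 * Pd R + Pl R))
  \/ (cond3 al alb /\ exists c : R, c != 0 /\
      F = cc c * Pd R * (Pl R) ^+ 2 * (Pd R + Pl R))
  \/ (cond4 al alb /\ exists c : R, c != 0 /\
      F = cc c * (Pl R) ^+ 2 * (4 * (Pd R) ^+ 3 + 6 * (Pd R) ^+ 2 * Pl R
                                - Pd R * (Pl R) ^+ 2 + cc alb * (Pl R) ^+ 3))
  \/ (cond5 al alb /\ exists c : R, c != 0 /\
      F = cc c * ((Pd R) ^+ 4 * (Pl R) ^+ 2 - 10 * (Pd R) ^+ 2 * (Pl R) ^+ 4
                  - 17 * Pd R * (Pl R) ^+ 5 - 8 * (Pl R) ^+ 6))
  \/ (cond6 al alb /\ exists c : R, c != 0 /\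
      F = cc c * ((Pd R) ^+ 4 * (Pl R) ^+ 3
                  - cc (2 * alb + 3) * (Pd R) ^+ 3 * (Pl R) ^+ 4
                  - cc (3 * alb) * (Pd R) ^+ 2 * (Pl R) ^+ 5
                  - cc (3 * alb + 1) * Pd R * (Pl R) ^+ 6
                  - cc (alb + 9 / 28) * (Pl R) ^+ 7)).

(* Main.v *)
Require Import Defs.
From HB Require Import structures.
From mathcomp Require Import all_boot all_order all_algebra.
From mathcomp Require Import polyXY ring zify.
Import Order.TTheory GRing.Theory Num.Theory.
Local Open Scope ring_scope.
Set Implicit Arguments.
Unset Strict Implicit.
Unset Printing Implicit Defensive.

(** The relation between L and W at lam = 0 reads b g = 0, so g = 0. After the
    substitution d -> d + be the remaining datum f is a 1-cocycle
      (d+l+al m) f(d,l) + (d+alb l) f(d+l,m) - (l <-> m) = (l-m) f(d,l+m),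
    and equivalence of extensions is equality modulo the coboundaries
      (d+alb l) phi(d+l) - (d+al l) phi(d).

    The coefficient of m^1 is an Euler identity: it makes f a coboundary outside
    total degree k + 1, where k = al - alb, so only natural k matter. For k = 0 it
    leaves a0 + a1 l. For k > 0 write f = sum_i c_i d^(k+1-i) l^i. The coefficients
    of m^0 and m^1 kill c_0 and c_1, and those of l^2 m^j determine all c_i from c_2
    and c_3. Let D be the determinant of (c_2, c_3) against the corresponding
    coefficients of the coboundary of d^k, so that f is a coboundary iff D = 0.
    For k = 1 always D = 0, and for k = 2, 3, 4 there is a cocycle with D <> 0.
    For k >= 5 the coefficient of l^3 m^4 gives
      ((al + alb - 1)^2 - (3 k + 1)) D = 0,
    which leaves alb = 0, -4 for k = 5 and al + alb - 1 = +- sqrt 19 for k = 6. For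
    k >= 7 the coefficient of l^3 m^6 gives on this quadric
    (k-1) (k-2) ... (k-6) D = 0, so D = 0. *)

Section PolynomialIdentities.
Variable R : numDomainType.

Lemma infinite_roots_eq0 (S : idomainType) (p : {poly S}) (x : nat -> S) :
  injective x -> (forall n, p.[x n] = 0) -> p = 0.
Proof.
move=> x_inj px0; apply/eqP; apply: contraT => /max_poly_roots size_roots.
have x_roots : all (root p) [seq x n | n <- iota 0 (size p)].
  by apply/allP => _ /mapP[n _ ->]; apply/rootP.
have := size_roots _ x_roots.
by rewrite map_inj_uniq // iota_uniq size_map size_iota ltnn => ->.
Qed.

Lemma natr_inj : injective (fun n : nat => n%:R : R).
Proof. exact: mulrIn (oner_neq0 R). Qed.

Lemma poly_ext (p q : {poly R}) : (forall x, p.[x] = q.[x]) -> p = q.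
Proof.
move=> pq; apply/subr0_eq/(infinite_roots_eq0 natr_inj) => n.
by rewrite hornerD hornerN pq subrr.
Qed.

Lemma poly2_ext (f g : {poly {poly R}}) :
  (forall l x, f.[l, x] = g.[l, x]) -> f = g.
Proof.
move=> fg; have x_inj := inj_comp (@polyC_inj R) natr_inj.
apply/subr0_eq/(infinite_roots_eq0 x_inj) => n.
by rewrite hornerD hornerN (poly_ext (fg n%:R)) subrr.
Qed.

Lemma poly3_ext (f g : {poly {poly {poly R}}}) :
  (forall m l x : R, f.[m%:P%:P].[l, x] = g.[m%:P%:P].[l, x]) -> f = g.
Proof.
move=> fg; have x_inj := inj_comp (@polyC_inj _) (inj_comp (@polyC_inj R) natr_inj).
apply/subr0_eq/(infinite_roots_eq0 x_inj) => n.
by rewrite hornerD hornerN (poly2_ext (fg n%:R)) subrr.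
Qed.

End PolynomialIdentities.

Lemma coef_poly_XaY (R : nzRingType) (p : {poly R}) i :
  (poly_XaY p)`_i = p^`N(i).
Proof.
elim/poly_ind: p i => [|p c IH] i; first by rewrite poly_XaY0 coef0 raddf0.
rewrite /poly_XaY rmorphD rmorphM /= map_polyX map_polyC comp_poly_MXaddC.
rewrite -/(poly_XaY p) mulrDr !coefD coefMX coefMC coefC !IH.
case: i => [|i] /=; first by rewrite !nderivn0 add0r.
by rewrite nderivnMXaddC addr0.
Qed.

Lemma horner2_poly_XaY (R : comNzRingType) (p : {poly R}) l x :
  (poly_XaY p).[l, x] = p.[x + l].
Proof. by rewrite horner_poly_XaY horner_comp !hornerE addrC. Qed.

Section TrivariateEvaluation.
Variable R : comNzRingType.
Implicit Types (m l x : R) (f : {poly {poly R}}) (h : {poly {poly {poly R}}}).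

Lemma horner3_map_poly_XaY f m l x :
  (map_poly poly_XaY f).[m%:P%:P].[l, x] = f.[m, x + l].
Proof.
rewrite /map_poly horner_poly (horner_coef f) !horner_sum.
apply: eq_bigr => i _; rewrite -!polyC_exp !hornerM !hornerC.
by rewrite horner2_poly_XaY.
Qed.

Lemma horner3_poly_XaY f m l x :
  (poly_XaY f).[m%:P%:P].[l, x] = f.[l + m, x].
Proof. by rewrite horner2_poly_XaY polyCD. Qed.

Lemma horner3_swapXY h m l x :
  (swapXY h).[m%:P%:P].[l, x] = h.[l%:P%:P].[m, x].
Proof. by rewrite horner2_swapXY. Qed.

End TrivariateEvaluation.

(** * Cochains and coboundaries *)

Section Cochains.
Variable R : fieldType.
Implicit Types (f g : {poly {poly R}}) (phi : {poly R}) (al alb l m x : R).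

Lemma horner2_cc c l x : (cc c).[l, x] = c :> R.
Proof. by rewrite !hornerC. Qed.

Lemma horner2_Pd l x : (Pd R).[l, x] = x.
Proof. by rewrite hornerC hornerX. Qed.

Lemma horner2_Pl l x : (Pl R).[l, x] = l.
Proof. by rewrite hornerX hornerC. Qed.

Definition horner2E :=
  (horner2_cc, horner2_Pd, horner2_Pl, horner2_poly_XaY, hornerE).

Lemma coef_ccM c f i s : (cc c * f)`_i`_s = c * f`_i`_s.
Proof. by rewrite !coefCM. Qed.

Lemma coef_PdM f i s : (Pd R * f)`_i`_s = if s is s'.+1 then f`_i`_s' else 0.
Proof. by rewrite coefCM coefXM; case: s. Qed.

Lemma coef_PlM f i s : (Pl R * f)`_i`_s = if i is i'.+1 then f`_i'`_s else 0.
Proof. by rewrite coefXM; case: i => //; rewrite coef0. Qed.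

Lemma coef_cc c i s : (cc c)`_i`_s = if (i, s) == (0, 0) then c else 0 :> R.
Proof. by rewrite coefC; case: i => [|i]; rewrite ?coefC ?coef0 //; case: s. Qed.

(* The value of L_lam on phi(d) v in the module M_(alb, 0). *)
Definition actL alb phi : {poly {poly R}} :=
  (Pd R + cc alb * Pl R) * poly_XaY phi.

(* The coefficient of d^(n-i) lam^(i+1) in (d + alb lam) (d + lam)^n. *)
Definition weight alb (n i : nat) : R := 'C(n, i.+1)%:R + alb * 'C(n, i)%:R.

Lemma weightn0 alb n : weight alb n 0 = n%:R + alb.
Proof. by rewrite /weight bin0 bin1 mulr1. Qed.

Lemma weightnn alb n : weight alb n n = alb.
Proof. by rewrite /weight binn bin_small // add0r mulr1. Qed.

Lemma weight_small alb n i : (n < i)%N -> weight alb n i = 0.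
Proof.
by move=> lt_ni; rewrite /weight !bin_small ?mulr0 ?addr0 // ltnW.
Qed.

Lemma coef_actL0 alb phi s :
  (actL alb phi)`_0`_s = if s is s'.+1 then phi`_s' else 0.
Proof.
rewrite /actL mulrDl -mulrA !coefD coef_ccM coef_PdM coef_PlM mulr0 addr0.
by case: s => // s; rewrite coef_poly_XaY nderivn0.
Qed.

Lemma coef_actLS alb phi i s :
  (actL alb phi)`_i.+1`_s = weight alb (s + i) i * phi`_(s + i).
Proof.
rewrite /actL /weight mulrDl -mulrA !coefD coef_ccM coef_PdM coef_PlM.
case: s => [|s]; rewrite !coef_poly_XaY !coef_nderivn.
  by rewrite addn0 add0n (@bin_small i i.+1) // binn mulr1n; ring.
rewrite !(addnC s.+1) addSnnS -![phi`_ _ *+ _]mulr_natr; ring.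
Qed.

Definition cobound al alb phi : {poly {poly R}} :=
  actL alb phi - (Pd R + cc al * Pl R) * phi%:P.

Lemma horner2_cobound al alb phi l x : (cobound al alb phi).[l, x] =
  (x + alb * l) * phi.[x + l] - (x + al * l) * phi.[x].
Proof. by rewrite /cobound /actL !horner2E. Qed.

Lemma coboundD al alb phi psi :
  cobound al alb (phi + psi) = cobound al alb phi + cobound al alb psi.
Proof. by rewrite /cobound /actL /poly_XaY !rmorphD /=; ring. Qed.

Lemma coef_cobound0 al alb phi s : (cobound al alb phi)`_0`_s = 0.
Proof.
rewrite /cobound mulrDl -mulrA !coefB !coefD coef_actL0 coef_ccM coef_PdM coef_PlM.
by rewrite mulr0 addr0; case: s => [|s]; rewrite ?coefC subrr.
Qed.

Lemma coef_coboundS al alb phi i s : (cobound al alb phi)`_i.+1`_s =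
  (weight alb (s + i) i - al *+ (i == 0)) * phi`_(s + i).
Proof.
rewrite /cobound mulrDl -mulrA !coefB !coefD coef_actLS coef_ccM coef_PdM coef_PlM.
rewrite !coefC mulrBl; case: i => [|i] /=.
  by rewrite addn0; case: s => [|s]; rewrite ?coef0 add0r.
by case: s => [|s]; rewrite !coef0 mulr0 addr0 mul0r.
Qed.

(* [f.[l, x]] is the value of f(d, lam) at d = x and lam = l. *)
Definition cocycle al alb f := forall l m x,
  (x + l + al * m) * f.[l, x] + (x + alb * l) * f.[m, x + l]
  - ((x + m + al * l) * f.[m, x] + (x + alb * m) * f.[l, x + m])
  = (l - m) * f.[l + m, x].

Lemma cocycle_cobound al alb phi : cocycle al alb (cobound al alb phi).
Proof.
move=> l m x; rewrite !horner2_cobound -(addrA x m l) (addrC m l) !addrA; ring.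
Qed.

Lemma cocycleB al alb f g :
  cocycle al alb f -> cocycle al alb g -> cocycle al alb (f - g).
Proof.
by move=> cf cg l m x; rewrite !hornerD !hornerN [RHS]mulrBr -cf -cg; ring.
Qed.

Lemma cocycleZ al alb c f : cocycle al alb f -> cocycle al alb (cc c * f).
Proof.
by move=> cf l m x; rewrite !hornerM !horner2_cc [RHS]mulrCA -cf; ring.
Qed.

Definition cohomologous al alb f g := exists phi, f = g + cobound al alb phi.

Lemma cohomologous_trans al alb f g h :
  cohomologous al alb f g -> cohomologous al alb g h -> cohomologous al alb f h.
Proof.
by move=> [phi ->] [psi ->]; exists (psi + phi); rewrite coboundD -addrA.
Qed.

(* The v_alb-component of L_lam (L_mu v_al) at be = 0, as a polynomial in mu, lam
   and d from the outermost variable inwards. *)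
Definition iter_actL al alb f : {poly {poly {poly R}}} :=
  ((Pd R + Pl R) * f)%:P + (cc al * f)%:P * 'X
  + (Pd R + cc alb * Pl R)%:P * map_poly poly_XaY f.

Lemma horner3_iter_actL al alb f m l x :
  (iter_actL al alb f).[m%:P%:P].[l, x] =
  (x + l + al * m) * f.[l, x] + (x + alb * l) * f.[m, x + l].
Proof.
by rewrite /iter_actL !(hornerD, hornerM) horner3_map_poly_XaY !hornerE /=; ring.
Qed.

Lemma coef_iter_actL al alb f j i s : (iter_actL al alb f)`_j`_i`_s =
  ((Pd R + Pl R) * f)`_i`_s *+ (j == 0) + (al * f`_i`_s) *+ (j == 1)
  + (actL alb f`_j)`_i`_s.
Proof.
rewrite /iter_actL !coefD coefC coefMX coefC coefCM coef_map_id0 ?poly_XaY0 //.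
by case: j => [|[|j]]; rewrite /= ?coef0 ?coef_ccM.
Qed.

End Cochains.

Section HomogeneousCochains.
Variable R : fieldType.
Implicit Types (f g : {poly {poly R}}) (phi : {poly R}) (al alb c t : R).

Definition homogeneous (n : nat) f := forall i s, (i + s != n)%N -> f`_i`_s = 0.

Lemma homogeneousB n f g :
  homogeneous n f -> homogeneous n g -> homogeneous n (f - g).
Proof. by move=> hf hg i s deg_ne; rewrite !coefB hf // hg // subr0. Qed.

Lemma homogeneousZ n c f : homogeneous n f -> homogeneous n (cc c * f).
Proof. by move=> hf i s deg_ne; rewrite coef_ccM hf // mulr0. Qed.

(* The coefficient of d^(k+1-i) lam^i. For i > k+1 the truncated subtraction makes it
   that of d^0 lam^i, which vanishes when f is homogeneous of degree k+1. *)
Definition diag_coef k f i : R := f`_i`_(k.+1 - i).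

Lemma diag_coef_cobound k al alb phi i : (i <= k)%N ->
  diag_coef k (cobound al alb phi) i.+1 =
  (weight alb k i - al *+ (i == 0)) * phi`_k.
Proof. by move=> le_ik; rewrite /diag_coef coef_coboundS subSS subnK. Qed.

Lemma homogeneous_coboundXn k al alb t :
  homogeneous k.+1 (cobound al alb (t *: 'X^k)).
Proof.
move=> [|i] s deg_ne; first exact: coef_cobound0.
rewrite coef_coboundS coefZ coefXn (_ : (s + i == k)%N = false) ?mulr0 //.
by move: deg_ne; rewrite addSn eqSS addnC => /negbTE.
Qed.

Lemma diag_coef_coboundXn k al alb t i :
  diag_coef k (cobound al alb (t *: 'X^k)) i.+2 = t * weight alb k i.+1.
Proof.
have [lt_ik|le_ki] := ltnP i k.
  by rewrite diag_coef_cobound // coefZ coefXn eqxx subr0 mulr1 mulrC.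
by rewrite weight_small ?mulr0 // /diag_coef homogeneous_coboundXn //; lia.
Qed.

Definition homog (k : nat) (s : seq R) : {poly {poly R}} :=
  \poly_(i < k.+2) (s`_i *: 'X^(k.+1 - i)).

Lemma coef_homog k s i j :
  (homog k s)`_i`_j = if (i + j == k.+1)%N then s`_i else 0.
Proof.
rewrite coef_poly; case: ltnP => [le_ik|lt_ki].
  rewrite coefZ coefXn -(eqn_add2l i) subnKC //.
  by case: eqP; rewrite ?mulr1 ?mulr0.
by rewrite coef0 gtn_eqF // ltn_addr.
Qed.

Lemma horner2_homog k s l x :
  (homog k s).[l, x] = \sum_(i < k.+2) s`_i * x ^+ (k.+1 - i) * l ^+ i.
Proof.
rewrite horner_poly horner_sum; apply: eq_bigr => i _.
by rewrite -polyC_exp hornerM hornerC hornerZ hornerXn.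
Qed.

Definition horner2_homogE := (horner2_homog, big_ord_recr, big_ord0).

Lemma homogeneous_homog k s : homogeneous k.+1 (homog k s).
Proof. by move=> i j; rewrite coef_homog => /negbTE->. Qed.

Lemma diag_coef_homog k s i : (i <= k.+1)%N -> diag_coef k (homog k s) i = s`_i.
Proof. by move=> le_ik; rewrite /diag_coef coef_homog subnKC ?eqxx. Qed.

End HomogeneousCochains.

(** * Coefficients of cocycles *)

Section CocycleCoefficients.
Variables (R : numFieldType) (al alb : R) (f : {poly {poly R}}).
Hypothesis cocycle_f : cocycle al alb f.

Lemma cocycle_iter_actL :
  iter_actL al alb f - swapXY (iter_actL al alb f) =
  ((Pl R)%:P - 'X) * poly_XaY f.
Proof.
apply: poly3_ext => m l x; rewrite 3!hornerD 3!hornerN horner3_swapXY.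
rewrite !horner3_iter_actL cocycle_f !(hornerD, hornerN, hornerM) horner3_poly_XaY.
by rewrite !(hornerC, hornerX).
Qed.

Lemma coef_cocycle j i s :
  (iter_actL al alb f)`_j`_i`_s - (iter_actL al alb f)`_i`_j`_s =
  (if i is i'.+1 then f`_(j + i')`_s *+ 'C(j + i', j) else 0)
  - (if j is j'.+1 then f`_(j' + i)`_s *+ 'C(j' + i, j') else 0).
Proof.
have /(congr1 (fun h : {poly {poly {poly R}}} => h`_j`_i`_s)) := cocycle_iter_actL.
rewrite mulrBl !coefB coef_swapXY => ->; rewrite coefCM coef_PlM coefXM.
congr (_ - _); first by case: i => // i; rewrite coef_poly_XaY coef_nderivn coefMn.
by case: j => [|j] /=; rewrite ?coef0 // coef_poly_XaY coef_nderivn coefMn.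
Qed.

Lemma cocycle_coef0 s : alb != 0 -> (0 < s)%N || (al != alb) -> f`_0`_s = 0.
Proof.
move=> albN0 s_al; have factorN0 : alb - al *+ (s == 0) != 0.
  by case: s s_al => [|s]; rewrite ?subr0 // mulr1n subr_eq0 eq_sym.
apply: (mulfI factorN0); rewrite mulr0.
have := coef_cocycle 0 s.+1 0; rewrite !coef_iter_actL coef_actL0 coef_actLS.
rewrite mulrDl !coefD coef_PdM coef_PlM !add0n weightnn bin0.
move=> /eqP; rewrite -subr_eq0 => /eqP rel; rewrite -[RHS]rel.
by case: s {s_al factorN0 rel} => [|s] /=; ring.
Qed.

Lemma cocycle_coef1 i s :
  (al - alb - (s + i.+1)%:R) * f`_i.+2`_s
  + weight alb (s + i.+1) i.+1 * f`_1`_(s + i.+1) = 0.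
Proof.
have := coef_cocycle 1 i.+2 s; rewrite !coef_iter_actL !coef_actLS weightn0.
rewrite addn0 add1n bin1 add0n bin0 natrD => /eqP; rewrite -subr_eq0 => /eqP rel.
by rewrite -[RHS]rel /=; ring.
Qed.

Lemma cocycle_coefSS i j s :
  weight alb (s + i.+1) i.+1 * f`_j.+2`_(s + i.+1)
  - weight alb (s + j.+1) j.+1 * f`_i.+2`_(s + j.+1)
  = ('C(j + i.+3, j.+2)%:R - 'C(j + i.+3, j.+1)%:R) * f`_(j + i.+3)`_s.
Proof.
have := coef_cocycle j.+2 i.+2 s; rewrite !coef_iter_actL !coef_actLS !add0r => ->.
by rewrite -!addSnnS; ring.
Qed.

Lemma cocycle_euler i s :
  ((s + i)%:R - (al - alb)) * f`_i.+1`_s = (cobound al alb f`_1)`_i.+1`_s.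
Proof.
rewrite coef_coboundS; case: i => [|i]; first by rewrite addn0 weightn0 /=; ring.
have /eqP := cocycle_coef1 i s; rewrite addrC addr_eq0 => /eqP rel.
by rewrite /= subr0 rel; ring.
Qed.

End CocycleCoefficients.

Lemma nonzero_coef2 (S : nzRingType) (f : {poly {poly S}}) :
  f != 0 -> exists i s, f`_i`_s != 0.
Proof.
rewrite -lead_coef_eq0 lead_coefE; set i := _.-1 => fi; exists i.
by exists (size f`_i).-1; rewrite -lead_coefE lead_coef_eq0.
Qed.

Section Normalization.
Variable R : numFieldType.
Implicit Types (f g : {poly {poly R}}) (al alb : R).

Lemma cocycle_normalize al alb f : alb != 0 -> cocycle al alb f ->
  exists g, [/\ cohomologous al alb f g, cocycle al alb g,
    forall s, (0 < s)%N || (al != alb) -> g`_0`_s = 0 &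
    forall i s, (s + i)%:R != al - alb -> g`_i.+1`_s = 0].
Proof.
move=> albN0 cf.
(* For n = al - alb the division by 0 gives 0. *)
pose phi := \poly_(n < size f`_1) (f`_1`_n / (n%:R - (al - alb))).
have phiE n : phi`_n = f`_1`_n / (n%:R - (al - alb)).
  by rewrite coef_poly; case: ltnP => // /(nth_default 0)->; rewrite mul0r.
have cg : cocycle al alb (f - cobound al alb phi).
  exact/cocycleB/cocycle_cobound.
exists (f - cobound al alb phi); split=> //.
- by exists phi; rewrite subrK.
- by move=> s; apply: cocycle_coef0 cg s albN0.
move=> i s; rewrite -subr_eq0 => degN0; rewrite 2!coefB coef_coboundS phiE mulrA.
by rewrite -coef_coboundS -(cocycle_euler cf) mulrAC mulfV // mul1r subrr.
Qed.

Lemma cocycle_trivial_or_natr al alb f : alb != 0 -> cocycle al alb f ->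
  cohomologous al alb f 0 \/ exists k : nat, al - alb = k%:R.
Proof.
move=> albN0 /(cocycle_normalize albN0)[g [fg _ g0 gS]].
have [g_eq0 | /nonzero_coef2[i [s gis]]] := eqVneq g 0.
  by rewrite g_eq0 in fg; left.
right; case: i gis => [|i] gis; last first.
  by exists (s + i)%N; apply/esym/eqP; apply: contraNT gis => /gS->.
exists 0%N; apply/eqP; rewrite subr_eq0; apply: contraNT gis => al_alb.
by rewrite g0 ?al_alb ?orbT.
Qed.

Lemma cocycle_normalize_affine alb f : alb != 0 -> cocycle alb alb f ->
  exists a0 a1, cohomologous alb alb f (cc a0 + cc a1 * Pl R).
Proof.
move=> albN0 /(cocycle_normalize albN0)[g [fg _ g0 gS]].
exists g`_0`_0, g`_1`_0; suff <- : g = cc g`_0`_0 + cc g`_1`_0 * Pl R by [].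
apply/polyP => i; apply/polyP => s.
rewrite !coefD coef_ccM coef_cc coefX.
case: i => [|[|i]] /=; rewrite ?coef0 ?mulr0 ?addr0 ?add0r.
- by case: s => // s; rewrite g0.
- by rewrite coef1; case: s => [|s]; rewrite ?mulr1 ?mulr0 // gS // subrr pnatr_eq0.
by rewrite gS // subrr pnatr_eq0 addnS.
Qed.

Lemma cocycle_normalize_homogeneous k al alb f :
  alb != 0 -> (0 < k)%N -> al - alb = k%:R -> cocycle al alb f ->
  exists g, [/\ cohomologous al alb f g, cocycle al alb g & homogeneous k.+1 g].
Proof.
move=> albN0 k_gt0 alk /(cocycle_normalize albN0)[g [fg cg g0 gS]].
exists g; split=> // -[|i] s is_k.
  by apply: g0; rewrite -subr_eq0 alk pnatr_eq0 -lt0n k_gt0 orbT.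
by apply: gS; rewrite alk eqr_nat addnC -eqSS -addSn.
Qed.

End Normalization.

(** * Homogeneous cocycles *)

Section HomogeneousCocycles.
Variable R : numFieldType.
Implicit Types (f : {poly {poly R}}) (al alb : R).

Lemma natr_binS (n i : nat) :
  'C(n, i.+1)%:R = (n%:R - i%:R) / i.+1%:R * 'C(n, i)%:R :> R.
Proof.
have iN0 : i.+1%:R != 0 :> R by rewrite pnatr_eq0.
apply: (mulfI iN0); rewrite -natrM mul_bin_left natrM mulrA mulrCA mulfV // mulr1.
by have [/natrB-> //|lt_ni] := leqP i n; rewrite bin_small // !mulr0.
Qed.

Lemma cocycle_diag_coef k al alb f i j :
  cocycle al alb f -> (0 < i)%N -> (0 < j)%N -> (i + j <= k)%N ->
  weight alb (k - j) i * diag_coef k f j.+1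
  - weight alb (k - i) j * diag_coef k f i.+1
  = ('C((i + j).+1, j.+1)%:R - 'C((i + j).+1, j)%:R) * diag_coef k f (i + j).+1.
Proof.
case: i j => [//|i] [//|j] cf _ _ ijk; rewrite /diag_coef.
have := cocycle_coefSS cf i j (k - (i.+1 + j.+1)).
have -> : (k - (i.+1 + j.+1) + i.+1 = k - j.+1)%N by lia.
have -> : (k - (i.+1 + j.+1) + j.+1 = k - i.+1)%N by lia.
by have -> : (j + i.+3 = (i.+1 + j.+1).+1)%N by lia.
Qed.

Lemma cocycle_rigid al alb f : cocycle al alb f ->
  (forall i s, (i < 4)%N -> f`_i`_s = 0) -> f = 0.
Proof.
move=> cf f_lt4; apply/polyP => i; apply/polyP => s; rewrite !coef0.
elim/ltn_ind: i s => i IH s; case: (ltnP i 4) => [/f_lt4 //|].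
case: i IH => [|[|[|[|i]]]] // IH _.
have /esym/eqP := cocycle_coefSS cf i.+1 0 s.
rewrite (IH i.+3) // (IH 2%N) // !mulr0 subrr mulf_eq0 => /orP[|/eqP //].
rewrite !natr_binS bin0 (_ : _ - _ = i.+1%:R * i.+4%:R / 2); last by field.
by rewrite !mulf_eq0 invr_eq0 !pnatr_eq0.
Qed.

Section NaturalDifference.
Variables (k : nat) (al alb : R).
Hypotheses (k_gt0 : (0 < k)%N) (albN0 : alb != 0) (alk : al - alb = k%:R).

Lemma homogeneous_rigid f : cocycle al alb f -> homogeneous k.+1 f ->
  diag_coef k f 2 = 0 -> diag_coef k f 3 = 0 -> f = 0.
Proof.
move=> cf hf f2 f3; apply: (cocycle_rigid cf) => i s lt_i4.
have [is_k|/eqP/hf //] := (i + s)%N =P k.+1.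
have {is_k} -> : s = (k.+1 - i)%N by lia.
case: i lt_i4 => [|[|[|[|//]]]] _ //.
  exact: (cocycle_coef0 cf).
have /eqP := cocycle_coef1 cf k.-1 0; rewrite add0n prednK // alk subrr mul0r add0r.
by rewrite weightnn mulf_eq0 (negbTE albN0) subSS subn0 => /eqP.
Qed.

Lemma weight2_neq0 : weight alb k 1 = 0 -> weight alb k 2 != 0.
Proof.
have kN0 : k%:R != 0 :> R by rewrite pnatr_eq0 -lt0n.
have -> : weight alb k 1 = k%:R * (k%:R - 1 + 2 * alb) / 2.
  by rewrite /weight !natr_binS bin0; field.
move/eqP; rewrite !mulf_eq0 (negbTE kN0) invr_eq0 pnatr_eq0 orbF addr_eq0.
move=> /eqP k_alb.
have -> : weight alb k 2 = alb * k%:R * k.+1%:R / 6.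
  by rewrite /weight !natr_binS bin0 -[k.+1%:R]natr1 -[k%:R](subrK 1) k_alb; field.
by rewrite !mulf_neq0 ?kN0 ?invr_neq0 ?pnatr_eq0.
Qed.

End NaturalDifference.
End HomogeneousCocycles.

Lemma det2_eq0_collinear (K : fieldType) (c2 c3 w2 w3 : K) :
  (w2 = 0 -> w3 != 0) -> c2 * w3 - c3 * w2 = 0 -> exists t, c2 = t * w2 /\ c3 = t * w3.
Proof.
move=> wN0 /subr0_eq det0; have [w20|w2N0] := eqVneq w2 0.
  exists (c3 / w3); rewrite mulfVK ?wN0 // w20 mulr0; split=> //.
  by apply: (mulIf (wN0 w20)); rewrite det0 w20 mulr0 mul0r.
by exists (c2 / w2); rewrite mulfVK // mulrAC det0 mulfK.
Qed.

Section LeadingDeterminant.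
Variable R : numFieldType.
Implicit Types (f g : {poly {poly R}}) (al alb c : R).

(* The determinant of the coefficients of lam^2 and lam^3, which determine a homogeneous
   cocycle of degree k+1, against those of the coboundary of d^k. *)
Definition lead_det k alb f : R :=
  diag_coef k f 2 * weight alb k 2 - diag_coef k f 3 * weight alb k 1.

Lemma lead_detB k alb f g :
  lead_det k alb (f - g) = lead_det k alb f - lead_det k alb g.
Proof. by rewrite /lead_det /diag_coef !coefB; ring. Qed.

Lemma lead_detZ k alb c f : lead_det k alb (cc c * f) = c * lead_det k alb f.
Proof. by rewrite /lead_det /diag_coef !coef_ccM; ring. Qed.

Lemma lead_det_cobound k al alb phi :
  (1 < k)%N -> lead_det k alb (cobound al alb phi) = 0.
Proof.
by move=> k_gt1; rewrite /lead_det !diag_coef_cobound ?(ltnW k_gt1) //=; ring.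
Qed.

Lemma lead_det_eq0_trivial k al alb f :
  (0 < k)%N -> alb != 0 -> al - alb = k%:R -> cocycle al alb f ->
  homogeneous k.+1 f -> lead_det k alb f = 0 -> cohomologous al alb f 0.
Proof.
move=> k_gt0 albN0 alk cf hf /det2_eq0_collinear-/(_ (weight2_neq0 k_gt0 albN0)).
move=> [t [f2 f3]]; exists (t *: 'X^k); rewrite add0r; apply: subr0_eq.
have diag_sub i : diag_coef k (f - cobound al alb (t *: 'X^k)) i.+2 =
    diag_coef k f i.+2 - t * weight alb k i.+1.
  by rewrite -(diag_coef_coboundXn k al alb) /diag_coef 2!coefB.
apply: (homogeneous_rigid k_gt0 albN0 alk).
- exact/cocycleB/cocycle_cobound.
- exact/homogeneousB/homogeneous_coboundXn.
- by rewrite diag_sub f2 subrr.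
by rewrite diag_sub f3 subrr.
Qed.

Lemma lead_det1 alb f : homogeneous 2 f -> lead_det 1 alb f = 0.
Proof.
move=> hf; rewrite /lead_det weight_small // mulr0 /diag_coef (hf 3) //.
by rewrite mul0r subrr.
Qed.

Lemma cocycle_diag_coef_rec k al alb f j :
  cocycle al alb f -> (1 < j)%N -> (j < k)%N ->
  diag_coef k f j.+2 =
  (weight alb (k - 1) j * diag_coef k f 2
   - weight alb (k - j) 1 * diag_coef k f j.+1) / (j.+2%:R * (j%:R - 1) / 2).
Proof.
case: j => [|[|j]] // cf _ lt_jk.
have := cocycle_diag_coef (k := k) (i := 1) (j := j.+2) cf isT isT lt_jk.
have -> : 'C((1 + j.+2).+1, j.+3)%:R - 'C((1 + j.+2).+1, j.+2)%:R
  = - (j.+4%:R * (j.+2%:R - 1) / 2) :> R.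
  by rewrite add1n binSn (@bin_sub j.+4 2) // !natr_binS bin0; field.
move=> rel; rewrite -[weight _ _ _ * _ - _]opprB {}rel; field.
rewrite (_ : 2 + j%:R - 1 = j.+1%:R); last by ring.
by rewrite -natrD !pnatr_eq0.
Qed.

(* The recursion expresses every coefficient through those of lam^2 and lam^3; in these
   terms the relation at lam^3 mu^4 is a multiple of the claim. *)
Lemma lead_det_quadric k al alb f : (4 < k)%N -> cocycle al alb f ->
  ((2 * alb + k%:R - 1) ^+ 2 - (3 * k%:R + 1)) * lead_det k alb f = 0.
Proof.
move=> k_gt4 cf; have lt_k j : (j < 5)%N -> (j < k)%N by lia.
have kN j : (j < 5)%N -> k%:R - j%:R != 0 :> R.
  by move=> lt_j5; rewrite subr_eq0 eqr_nat; lia.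
have factorN0 : (k%:R - 2) * (k%:R - 3) * (k%:R - 4) != 0 :> R.
  by rewrite !mulf_neq0 ?kN.
have /eqP := cocycle_diag_coef (i := 2) (j := 3) cf isT isT k_gt4.
rewrite -subr_eq0 => /eqP rel; apply: (mulfI factorN0).
rewrite [RHS]mulr0 -(mulr0 (72 * k%:R)) -{}rel.
have diag_rec j := cocycle_diag_coef_rec (k := k) (j := j) cf.
rewrite /lead_det (diag_rec 4%N) ?(diag_rec 3%N) ?(diag_rec 2%N) ?lt_k //.
by rewrite /weight !natr_binS !bin0 !natrB ?(ltnW (lt_k _ _)) //; field.
Qed.

(* On the quadric both k and alb are polynomials in s = 2 alb + k - 1, and the relation
   at lam^3 mu^6 becomes a multiple of the claim. *)
Lemma lead_det_large k al alb f :
  (6 < k)%N -> cocycle al alb f -> lead_det k alb f = 0.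
Proof.
move=> k_gt6 cf; have lt_k j : (j < 7)%N -> (j < k)%N by lia.
have /eqP := lead_det_quadric (ltnW (ltnW k_gt6)) cf.
rewrite mulf_eq0 => /orP[|/eqP //].
set s := _ + _ - 1; rewrite subr_eq0 => /eqP s2.
have kE : k%:R = (s ^+ 2 - 1) / 3 by rewrite s2; field.
have albE : alb = (s - k%:R + 1) / 2 by rewrite /s; field.
have factorN0 : \prod_(j < 6) (k%:R - j.+1%:R) != 0 :> R.
  by apply/prodf_neq0 => -[j lt_j] _; rewrite subr_eq0 eqr_nat gtn_eqF ?lt_k.
have /eqP := cocycle_diag_coef (i := 2) (j := 5) cf isT isT k_gt6.
rewrite -subr_eq0 => /eqP rel; apply: (mulfI factorN0).
rewrite [RHS]mulr0 -(mulr0 (- 14400)) -{}rel.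
have diag_rec j := cocycle_diag_coef_rec (k := k) (j := j) cf.
rewrite /lead_det (diag_rec 6%N) ?(diag_rec 5%N) ?(diag_rec 4%N) ?(diag_rec 3%N)
  ?(diag_rec 2%N) ?lt_k //.
rewrite /weight !natr_binS !bin0 !natrB ?(ltnW (lt_k _ _)) //.
by rewrite !big_ord_recr big_ord0 /=; clearbody s; rewrite albE kE; field.
Qed.

End LeadingDeterminant.

(** * Classification *)

Section Classification.
Variable R : numFieldType.
Implicit Types (f : {poly {poly R}}) (al alb : R).

(* For k = 5, 6 this is (al + alb - 1)^2 = 3 k + 1, without the root alb = 0 at k = 5. *)
Definition exceptional (k : nat) alb : bool :=
  match k with
  | 2 | 3 | 4 => true
  | 5 => alb == -4
  | 6 => (2 * alb + 5) ^+ 2 == 19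
  | _ => false
  end.

Lemma exceptional_gt1 k alb : exceptional k alb -> (1 < k)%N.
Proof. by case: k => [|[|]]. Qed.

Lemma lead_det_exceptional k al alb f : (0 < k)%N -> alb != 0 ->
  cocycle al alb f -> homogeneous k.+1 f -> lead_det k alb f != 0 ->
  exceptional k alb.
Proof.
move=> k_gt0 albN0 cf hf detN0.
have [k_gt6|k_le6] := ltnP 6 k.
  by rewrite (lead_det_large _ cf) ?eqxx in detN0.
have [k_gt4|] := ltnP 4 k; last first.
  by case: k k_gt0 {k_le6 cf} hf detN0 => [|[|[|[|[|]]]]] // _ /lead_det1-> /eqP.
have /eqP := lead_det_quadric k_gt4 cf.
rewrite mulf_eq0 (negbTE detN0) orbF subr_eq0.
have [-> | ->] : k = 5 \/ k = 6 by lia.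
  rewrite -subr_eq0 (_ : _ - _ = 4 * alb * (alb + 4)); last by ring.
  by rewrite !mulf_eq0 pnatr_eq0 (negbTE albN0) addr_eq0.
by congr (_ ^+ 2 == _); ring.
Qed.

Definition basic_cocycle (k : nat) alb : {poly {poly R}} :=
  homog k
    match k with
    | 2 => [:: 0; 0; 2; 1]
    | 3 => [:: 0; 0; 1; 1]
    | 4 => [:: 0; 0; 4; 6; -1; alb]
    | 5 => [:: 0; 0; 1; 0; -10; -17; -8]
    | 6 => [:: 0; 0; 0; 1; - (2 * alb + 3); - (3 * alb); - (3 * alb + 1);
               - (alb + 9 / 28)]
    | _ => [::]
    end.

Lemma cocycle_basic k al alb :
  exceptional k alb -> al - alb = k%:R -> cocycle al alb (basic_cocycle k alb).
Proof.
move=> exc /eqP; rewrite subr_eq => /eqP-> l m x.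
case: k exc => [|[|[|[|[|[|[|]]]]]]] //= exc; rewrite !horner2_homogE /=.
- ring.
- ring.
- ring.
- by rewrite (eqP exc); ring.
move/eqP: exc; set s := _ + 5 => s2.
by rewrite (_ : alb = (s - 5) / 2); [clearbody s; field: s2 | rewrite /s; field].
Qed.

Lemma lead_det_basic k alb :
  exceptional k alb -> lead_det k alb (basic_cocycle k alb) != 0.
Proof.
move=> exc; have k_gt1 := exceptional_gt1 exc.
rewrite /lead_det !diag_coef_homog ?ltnS ?(ltnW k_gt1) //.
case: k exc {k_gt1} => [|[|[|[|[|[|[|]]]]]]] //= exc;
  rewrite /weight !natr_binS !bin0.
- by rewrite (_ : _ - _ = - 1%:R) ?oppr_eq0 ?pnatr_eq0 //; field.
- by rewrite (_ : _ - _ = - 2%:R) ?oppr_eq0 ?pnatr_eq0 //; field.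
- by rewrite (_ : _ - _ = - 20%:R) ?oppr_eq0 ?pnatr_eq0 //; field.
- by rewrite (eqP exc) (_ : _ - _ = - 30%:R) ?oppr_eq0 ?pnatr_eq0 //; field.
rewrite (_ : _ - _ = - 3 * (2 * alb + 5)); last by field.
rewrite mulf_neq0 ?oppr_eq0 ?pnatr_eq0 //.
by apply: contraTneq exc => ->; rewrite expr0n eq_sym pnatr_eq0.
Qed.

Lemma homogeneous_classify k al alb f : (0 < k)%N -> alb != 0 -> al - alb = k%:R ->
  cocycle al alb f -> homogeneous k.+1 f ->
  cohomologous al alb f 0 \/
  exists c, [/\ c != 0, exceptional k alb
    & cohomologous al alb f (cc c * basic_cocycle k alb)].
Proof.
move=> k_gt0 albN0 alk cf hf.
have [det0|detN0] := eqVneq (lead_det k alb f) 0.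
  by left; apply: lead_det_eq0_trivial det0.
right; have exc := lead_det_exceptional k_gt0 albN0 cf hf detN0.
have basicN0 := lead_det_basic exc.
pose c := lead_det k alb f / lead_det k alb (basic_cocycle k alb).
exists c; split=> //; first by rewrite mulf_neq0 ?invr_neq0.
set g := cc c * basic_cocycle k alb.
have [|||phi fE] := lead_det_eq0_trivial (f := f - g) k_gt0 albN0 alk.
- exact/cocycleB/cocycleZ/cocycle_basic.
- exact/homogeneousB/homogeneousZ/homogeneous_homog.
- by rewrite lead_detB lead_detZ mulfVK // subrr.
by exists phi; rewrite -[LHS](subrK g) fE add0r addrC.
Qed.

End Classification.

Section GoodCocycles.
Variable R : numFieldType.
Implicit Types (f F : {poly {poly R}}) (al alb : R).

Lemma basic_cocycle2 alb :
  basic_cocycle 2 alb = Pl R ^+ 2 * (2 * Pd R + Pl R).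
Proof. by apply: poly2_ext => l x; rewrite !horner2_homogE !horner2E /=; ring. Qed.

Lemma basic_cocycle3 alb :
  basic_cocycle 3 alb = Pd R * Pl R ^+ 2 * (Pd R + Pl R).
Proof. by apply: poly2_ext => l x; rewrite !horner2_homogE !horner2E /=; ring. Qed.

Lemma basic_cocycle4 alb :
  basic_cocycle 4 alb =
  Pl R ^+ 2 * (4 * Pd R ^+ 3 + 6 * Pd R ^+ 2 * Pl R - Pd R * Pl R ^+ 2
               + cc alb * Pl R ^+ 3).
Proof. by apply: poly2_ext => l x; rewrite !horner2_homogE !horner2E /=; ring. Qed.

Lemma basic_cocycle5 alb :
  basic_cocycle 5 alb =
  Pd R ^+ 4 * Pl R ^+ 2 - 10 * Pd R ^+ 2 * Pl R ^+ 4 - 17 * Pd R * Pl R ^+ 5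
  - 8 * Pl R ^+ 6.
Proof. by apply: poly2_ext => l x; rewrite !horner2_homogE !horner2E /=; ring. Qed.

Lemma basic_cocycle6 alb :
  basic_cocycle 6 alb =
  Pd R ^+ 4 * Pl R ^+ 3 - cc (2 * alb + 3) * Pd R ^+ 3 * Pl R ^+ 4
  - cc (3 * alb) * Pd R ^+ 2 * Pl R ^+ 5 - cc (3 * alb + 1) * Pd R * Pl R ^+ 6
  - cc (alb + 9 / 28) * Pl R ^+ 7.
Proof. by apply: poly2_ext => l x; rewrite !horner2_homogE !horner2E /=; ring. Qed.

Lemma cond5P al alb : cond5 al alb <-> exceptional 5 alb /\ al - alb = 5%:R.
Proof.
split=> [[-> ->]|[/eqP-> alE]]; first by split; [exact: eqxx | ring].
by split=> //; rewrite -[al](subrK (-4)) alE; ring.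
Qed.

Lemma cond6P al alb : cond6 al alb <-> exceptional 6 alb /\ al - alb = 6%:R.
Proof.
split=> [[s [s2 [-> ->]]]|[/eqP s2 alE]].
  by split; [apply/eqP; rewrite -s2 | ]; field.
exists (2 * alb + 5); split=> //; split; last by field.
by rewrite -[al](subrK alb) alE; field.
Qed.

Lemma good_pairP al alb : good_pair al alb <->
  al = alb \/ exists2 k, exceptional k alb & al - alb = k%:R.
Proof.
rewrite /good_pair cond5P cond6P; split.
  case=> [|[|[|[|[[]|[]]]]]]; first by left.
  - by right; exists 2%N.
  - by right; exists 3%N.
  - by right; exists 4%N.
  - by right; exists 5%N.
  by right; exists 6%N.
case=> [|[k exc alk]]; first by left.
by right; case: k exc alk => [|[|[|[|[|[|[|]]]]]]] //; tauto.
Qed.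

Lemma good_FP al alb F : good_F al alb F <->
  (al = alb /\ exists a0 a1, (a0, a1) != (0, 0) /\ F = cc a0 + cc a1 * Pl R) \/
  exists k c, [/\ exceptional k alb, al - alb = k%:R, c != 0
    & F = cc c * basic_cocycle k alb].
Proof.
rewrite /good_F cond5P cond6P; split.
  case=> [|[|[|[|[|]]]]] [alk]; first by left.
  - case=> c [cN0 ->]; right; exists 2%N, c.
    by split=> //; rewrite basic_cocycle2; ring.
  - case=> c [cN0 ->]; right; exists 3%N, c.
    by split=> //; rewrite basic_cocycle3; ring.
  - case=> c [cN0 ->]; right; exists 4%N, c.
    by split=> //; rewrite basic_cocycle4; ring.
  - by case: alk => ? ? [c [cN0 ->]]; right; exists 5%N, c; rewrite basic_cocycle5.
  by case: alk => ? ? [c [cN0 ->]]; right; exists 6%N, c; rewrite basic_cocycle6.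
case=> [|[k [c [exc alk cN0 ->]]]]; first by left.
right; case: k exc alk => [|[|[|[|[|[|[|]]]]]]] // exc alk.
- by left; split=> //; exists c; split=> //; rewrite basic_cocycle2; ring.
- by right; left; split=> //; exists c; split=> //; rewrite basic_cocycle3; ring.
- by do 2 right; left; split=> //; exists c; split=> //; rewrite basic_cocycle4; ring.
- by do 3 right; left; split=> //; exists c; rewrite basic_cocycle5.
by do 4 right; split=> //; exists c; rewrite basic_cocycle6.
Qed.

Lemma good_pair_good_F al alb : good_pair al alb <-> exists F, good_F al alb F.
Proof.
rewrite good_pairP; split=> [[alE|[k exc alk]]|[F /good_FP]].
- exists (cc 1 + cc 0 * Pl R); apply/good_FP; left; split=> //; exists 1, 0.
  by rewrite xpair_eqE oner_eq0.
- exists (cc 1 * basic_cocycle k alb); apply/good_FP; right; exists k, 1.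
  by rewrite oner_eq0.
by case=> [[alE _]|[k [c [exc alk _ _]]]]; [left | right; exists k].
Qed.

Lemma good_F_cocycle al alb F : good_F al alb F -> cocycle al alb F.
Proof.
move=> /good_FP[[-> [a0 [a1 [_ ->]]]] | [k [c [exc alk _ ->]]]].
  by move=> l m x; rewrite !horner2E; ring.
exact/cocycleZ/cocycle_basic.
Qed.

Lemma good_F_nontrivial al alb F : good_F al alb F -> ~ cohomologous al alb F 0.
Proof.
move=> /good_FP[[-> [a0 [a1 [aN0 ->]]]] | [k [c [exc alk cN0 ->]]]] [phi FE].
  case/negP: aN0; rewrite add0r in FE; apply/eqP; congr (_, _).
    have /(congr1 (fun f : {poly {poly R}} => f`_0`_0)) := FE.
    by rewrite coef_cobound0 !coefD coef_ccM coef_cc coefX coef0 mulr0 addr0.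
  have /(congr1 (fun f : {poly {poly R}} => f`_1`_0)) := FE.
  rewrite coef_coboundS !coefD coef_ccM coef_cc coefX coef1 weightn0 /=.
  by rewrite add0r mulr1 => ->; ring.
have /eqP := lead_det_cobound al alb phi (exceptional_gt1 exc).
rewrite -[cobound _ _ _]add0r -FE lead_detZ mulf_eq0 (negbTE cN0).
exact/negP/lead_det_basic.
Qed.

Lemma cocycle_classify al alb f : alb != 0 -> cocycle al alb f ->
  cohomologous al alb f 0 \/ exists2 F, good_F al alb F & cohomologous al alb f F.
Proof.
move=> albN0 cf; have [|[k alk]] := cocycle_trivial_or_natr albN0 cf; first by left.
have [k0|k_gt0] := posnP k.
  move: alk; rewrite k0 => /subr0_eq alE; rewrite alE in cf *.
  have [a0 [a1 fE]] := cocycle_normalize_affine albN0 cf.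
  have [[a00 a10]|aN0] := eqVneq (a0, a1) (0, 0).
    by left; move: fE; rewrite a00 a10 /cc !polyC0 mul0r addr0.
  right; exists (cc a0 + cc a1 * Pl R) => //.
  by apply/good_FP; left; split=> //; exists a0, a1.
have [g [fg cg hg]] := cocycle_normalize_homogeneous albN0 k_gt0 alk cf.
have [g0|[c [cN0 exc gE]]] := homogeneous_classify k_gt0 albN0 alk cg hg.
  by left; apply: cohomologous_trans fg g0.
right; exists (cc c * basic_cocycle k alb); last exact: cohomologous_trans fg gE.
by apply/good_FP; right; exists k, c.
Qed.

End GoodCocycles.

(** * Extensions *)

Section Action.
Variable R : fieldType.
Implicit Types (f g F : {poly {poly R}}) (al alb be : R).

Lemma horner_shiftp l (p : {poly R}) x : (shiftp l p).[x] = p.[x + l].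
Proof. by rewrite horner_comp !hornerE. Qed.

Lemma horner2_subbeta be F l x : (subbeta be F).[l, x] = F.[l, x + be].
Proof.
have -> : (subbeta be F).[l%:P] = F.[l%:P] \Po ('X + be%:P).
  by rewrite -(horner_map (comp_poly ('X + be%:P))) /= comp_polyC.
by rewrite horner_comp !hornerE.
Qed.

Lemma subbeta0 be : subbeta be (0 : {poly {poly R}}) = 0.
Proof. exact: map_poly0. Qed.

Lemma horner_actL1 al alb be f g l v x : (act al alb be f g GL l v).1.[x] =
  v.1.[x + l] * (x + alb * l + be) + v.2.[x + l] * f.[l, x].
Proof. by rewrite /= !(hornerD, hornerM, horner_shiftp, hornerX, hornerC) addrA. Qed.

Lemma horner_actL2 al alb be f g l v x :
  (act al alb be f g GL l v).2.[x] = v.2.[x + l] * (x + al * l + be).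
Proof. by rewrite /= !(hornerD, hornerM, horner_shiftp, hornerX, hornerC) addrA. Qed.

Lemma horner_actW1 al alb be f g l v x :
  (act al alb be f g GW l v).1.[x] = v.2.[x + l] * g.[l, x].
Proof. by rewrite /= !hornerM !horner_shiftp. Qed.

Lemma act_W0 al alb be f l v : act al alb be f 0 GW l v = (0, 0).
Proof. by rewrite /act /evl horner0 mulr0. Qed.

Lemma act_0 al alb be f g X l : act al alb be f g X l (0, 0) = (0, 0).
Proof. by case: X; rewrite /act /shiftp !comp_poly0 !mul0r ?addr0. Qed.

End Action.

Section Extensions.
Variable R : numFieldType.
Implicit Types (f g F G : {poly {poly R}}) (a b al alb be : R).

Lemma poly_pair_ext (v w : {poly R} * {poly R}) :
  (forall x, v.1.[x] = w.1.[x]) -> (forall x, v.2.[x] = w.2.[x]) -> v = w.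
Proof.
by case: v w => [v1 v2] [w1 w2] /= vw1 vw2; rewrite (poly_ext vw1) (poly_ext vw2).
Qed.

Lemma subbetaK be : cancel (subbeta (- be)) (subbeta be).
Proof. by move=> f; apply: poly2_ext => l x; rewrite !horner2_subbeta addrK. Qed.

Lemma is_ext_g_eq0 a b al alb be f g :
  b != 0 -> is_ext a b al alb be f g -> g = 0.
Proof.
move=> bN0 ext; apply: poly2_ext => m x; apply: (mulfI bN0).
have [_ /(congr1 (fun v => v.1.[x])) + _ _] := ext 0 m (0, 1).
rewrite /esub /escal [LHS]hornerD hornerN [RHS]hornerZ.
rewrite !(horner_actL1, horner_actL2, horner_actW1) /= !hornerC !addr0.
rewrite add0r => /esym/eqP; rewrite -subr_eq0 => /eqP rel.
by rewrite [RHS]mulr0 -[RHS]rel; ring.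
Qed.

Lemma is_ext_subbeta_cocycle a b al alb be F :
  is_ext a b al alb be (subbeta be F) 0 <-> cocycle al alb F.
Proof.
split=> [ext l m x|cF l m v].
  have [/(congr1 (fun v => v.1.[x - be])) + _ _ _] := ext l m (0, 1).
  rewrite /esub /escal [LHS]hornerD hornerN [RHS]hornerZ.
  rewrite !(horner_actL1, horner_actL2) /= !horner0 !hornerC !horner2_subbeta.
  rewrite !(addrAC x (- be)) !subrK !addrK => rel.
  by apply: etrans (etrans _ rel) _; ring.
split; rewrite ?act_W0 ?act_0.
- rewrite /esub /escal; congr (_, _); apply: poly_ext => x.
    rewrite hornerD hornerN hornerZ !(horner_actL1, horner_actL2) !horner2_subbeta.
    have := cF l m (x + be).
    rewrite !(addrAC x _ be) (addrAC x m l) (addrA x l m) => /eqP.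
    rewrite -subr_eq0 => /eqP rel; apply/subr0_eq.
    by rewrite -[RHS](mulr0 v.2.[x + l + m]) -{}rel; ring.
  rewrite hornerD hornerN hornerZ !(horner_actL1, horner_actL2).
  by rewrite (addrAC x m l) (addrA x l m); ring.
- by rewrite /esub /escal /= subr0 scaler0.
- by rewrite /esub /escal /= subr0 scaler0.
by rewrite /esub /= subr0.
Qed.

Lemma ext_equiv_cohomologous al alb be F G :
  ext_equiv al alb be (subbeta be F) 0 (subbeta be G) 0 ->
  cohomologous al alb F G.
Proof.
move=> [Phi [PhiD PhiM Phi1 Phi2 PhiA]].
set psi := (Phi (0, 1)).1.
have Phi_fst v x : (Phi v).1.[x] = v.1.[x] + v.2.[x] * psi.[x].
  have {1}-> : v = eadd (v.1, 0) (epmul v.2 (0, 1)).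
    by case: v => v1 v2; rewrite /eadd /epmul /= mulr0 mulr1 addr0 add0r.
  by rewrite PhiD PhiM Phi1 hornerD hornerM.
exists (psi \Po ('X - be%:P)); apply: poly2_ext => l x.
have := congr1 (fun v => v.1.[x - be]) (PhiA GL l (0, 1)).
rewrite Phi_fst !(horner_actL1, horner_actL2) Phi_fst Phi2 /= !horner0 !hornerC.
rewrite !horner2_subbeta 2!hornerD horner2_cobound.
rewrite !horner_comp !(hornerD, hornerX, hornerN, hornerC).
rewrite !(addrAC x (- be)) !subrK !addrK => /eqP.
rewrite -subr_eq0 => /eqP rel; apply/subr0_eq; rewrite -[RHS]rel; ring.
Qed.

Lemma cohomologous_ext_equiv al alb be F G :
  cohomologous al alb F G ->
  ext_equiv al alb be (subbeta be F) 0 (subbeta be G) 0.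
Proof.
move=> [phi FE].
pose psi := phi \Po ('X + be%:P).
have psiE x : psi.[x] = phi.[x + be] by rewrite horner_comp !hornerE.
exists (fun v => (v.1 + v.2 * psi, v.2)); split=> //.
- by move=> v w; rewrite /eadd /=; congr (_, _); ring.
- by move=> r v; rewrite /epmul /=; congr (_, _); ring.
- by move=> p /=; rewrite mul0r addr0.
case=> l v; last by rewrite !act_W0 /= mul0r addr0.
apply: poly_pair_ext => x //.
rewrite [LHS]hornerD hornerM !(horner_actL1, horner_actL2) /= hornerD hornerM.
rewrite !horner2_subbeta FE 2!hornerD horner2_cobound !psiE (addrAC x l be); ring.
Qed.

Lemma ext_trivial_subbeta al alb be F :
  ext_trivial al alb be (subbeta be F) 0 <-> cohomologous al alb F 0.
Proof.
rewrite /ext_trivial -[X in ext_equiv _ _ _ _ _ X _](subbeta0 be).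
by split=> [/ext_equiv_cohomologous|/cohomologous_ext_equiv].
Qed.

End Extensions.

Theorem theorem3p9 (R : numClosedFieldType) (a b al alb be : R) :
  b != 0 -> al != 0 -> alb != 0 ->
  [/\ forall f g : {poly {poly R}}, is_ext a b al alb be f g -> g = 0,
      (exists f g : {poly {poly R}},
          is_ext a b al alb be f g /\ ~ ext_trivial al alb be f g)
        <-> good_pair al alb
    & forall f g : {poly {poly R}},
        is_ext a b al alb be f g -> ~ ext_trivial al alb be f g ->
        exists F : {poly {poly R}},
          [/\ good_F al alb F, is_ext a b al alb be (subbeta be F) 0
            & ext_equiv al alb be f g (subbeta be F) 0]].
Proof.
move=> bN0 _ albN0.
have classify f g : is_ext a b al alb be f g -> ~ ext_trivial al alb be f g ->
    exists F, [/\ good_F al alb F, is_ext a b al alb be (subbeta be F) 0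
      & ext_equiv al alb be f g (subbeta be F) 0].
  move=> ext; have g0 := is_ext_g_eq0 bN0 ext; move: ext; rewrite {}g0.
  rewrite -[f](subbetaK be) => /is_ext_subbeta_cocycle cf nontrivial.
  have [/ext_trivial_subbeta //|[F goodF fF]] := cocycle_classify albN0 cf.
  exists F; split=> //; last exact: cohomologous_ext_equiv.
  exact/is_ext_subbeta_cocycle/good_F_cocycle.
split=> //; first by move=> f g; apply: is_ext_g_eq0.
rewrite good_pair_good_F; split=> [[f [g [ext]]]|[F goodF]].
  by move=> /(classify f g ext)[F [goodF _ _]]; exists F.
exists (subbeta be F), 0; split; first exact/is_ext_subbeta_cocycle/good_F_cocycle.
by move/ext_trivial_subbeta; apply: good_F_nontrivial.
Qed.
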